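(* For $k\in\{0,1,2,\ldots\}$ let $\phi_k:[0,1]\to[0,1]$ be the infinitely piecewise linear map given by $\phi_k(x)=\frac{2}{2^k}\left(x-\frac12\right)$ for $x\in[\frac12,1]$, and $\phi_k(x)=2^i\left(x-\frac{1}{2^i}\right)$ for $x\in[2^{-i},2^{1-i})$, $i=2,3,\ldots$ (with $\phi_k(0)=0$), and let $\rho^{(k)}$ be the invariant density of $\phi_k$. Then for every $k\in\{0,1,2,\ldots\}$ the global Lyapunov exponent $$\Lambda^{(k)}=\int_0^1\rho^{(k)}(x)\,\log_2\phi_k'(x)\,dx$$ of $\phi_k$ satisfies $$\Lambda^{(k)}=2.$$
   Context: An invariant density of a Borel measurable map $\phi:[0,1]\to[0,1]$ is a probability density $\rho$ on $[0,1]$ with respect to Lebesgue measure (i.e. $\rho\ge 0$ is measurable and $\int_0^1\rho(x)\,dx=1$) such that the measure $\mu(A)=\int_A\rho(x)\,dx$ is $\phi$-invariant: $\mu(\phi^{-1}(A))=\mu(A)$ for every Borel set $A\subseteq[0,1]$. Equivalently, $\rho$ is a fixed point of the Perron–Frobenius operator of $\phi$. Densities that are equal Lebesgue-almost everywhere are identified. The derivative $\phi_k'$ is taken piecewise, at interior points of the intervals of linearity (points of continuity of $\phi_k$), hence is defined for all $x\in[0,1]$ outside a countable set. The global Lyapunov exponent of $\phi_k$ is defined by the displayed integral formula, with logarithm to base $2$. *)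

(* Defs.v *)
From mathcomp Require Import all_boot all_order all_algebra.
From mathcomp Require Import all_classical all_reals all_analysis.

Set Implicit Arguments.
Unset Strict Implicit.
Unset Printing Implicit Defensive.

Import Order.TTheory GRing.Theory Num.Theory.
Import numFieldNormedType.Exports.

Local Open Scope classical_set_scope.
Local Open Scope ring_scope.

(** The index [i > 1] of the dyadic interval [2^-i, 2^(1-i)[ containing [x];
    it exists, and is then unique, exactly when [0 < x < 1/2]. *)
Definition dyadic_index (R : realType) (x : R) : nat :=
  xget 0%N [set i : nat | (1 < i)%N /\ 2 ^- i <= x < 2 ^- (i - 1)].

(** Maps from [[0, 1]] to itself are represented by functions [R -> R] whose
    values outside [[0, 1]] are irrelevant. *)
Definition phi (R : realType) (k : nat) (x : R) : R :=
  if 2^-1 <= x <= 1 then 2 / 2 ^+ k * (x - 2^-1)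
  else if 0 < x < 2^-1 then
    2 ^+ dyadic_index x * (x - 2 ^- dyadic_index x)
  else 0.

Lemma phi0 (R : realType) (k : nat) : phi k (0 : R) = 0.
Proof. by rewrite /phi ltxx /= leNgt invr_gt0 ltr0n. Qed.

Lemma phi_right (R : realType) (k : nat) (x : R) :
  2^-1 <= x <= 1 -> phi k x = 2 / 2 ^+ k * (x - 2^-1).
Proof. by rewrite /phi => ->. Qed.

Lemma phi_dyadic (R : realType) (k i : nat) (x : R) : (1 < i)%N ->
  2 ^- i <= x < 2 ^- (i - 1) -> phi k x = 2 ^+ i * (x - 2 ^- i).
Proof.
have pow_le m n : (m <= n)%N -> 2 ^- n <= 2 ^- m :> R.
  by move=> mn; rewrite lef_pV2 ?posrE ?exprn_gt0// ler_eXn2l ?ltr1n.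
have uniq_le m n : 2 ^- m <= x -> x < 2 ^- (n - 1) -> (n <= m)%N.
  move=> mx xn; rewrite leqNgt; apply/negP => mn.
  have /pow_le h : (m <= n - 1)%N by rewrite leq_subRL ?(leq_ltn_trans _ mn).
  by have := lt_le_trans xn (le_trans h mx); rewrite ltxx.
move=> i1 /andP[ix xi].
have x2 : x < 2^-1.
  by apply: lt_le_trans xi _; rewrite -[2^-1]/(2 ^- 1) pow_le// leq_subRL// ltnW.
have x0 : 0 < x by apply: lt_le_trans ix; rewrite invr_gt0 exprn_gt0.
rewrite /phi leNgt x2 x0 /=; suff -> : dyadic_index x = i by [].
rewrite /dyadic_index; case: xgetP => [j _ [_ /andP[jx xj]]|/(_ i)].
  by apply/eqP; rewrite eqn_leq !uniq_le.
by case; split=> //; apply/andP.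
Qed.

Definition density_measure (R : realType) (rho : R -> R) (A : set R) : \bar R :=
  (\int[lebesgue_measure]_(x in A) (rho x)%:E)%E.

(** The preimage is taken within the domain [[0, 1]] of [f]. *)
Definition invariant_density (R : realType) (f rho : R -> R) : Prop :=
  [/\ measurable_fun (`[0, 1]%classic : set R) rho,
      forall x, 0 <= x <= 1 -> 0 <= rho x,
      density_measure rho `[0, 1] = 1%E
    & forall A : set R, measurable A -> A `<=` `[0, 1] ->
        density_measure rho (`[0, 1] `&` f @^-1` A) = density_measure rho A].

Definition log2 (R : realType) (x : R) : R := ln x / ln 2.

(** [derive1] is total; its value where [f] is not
    differentiable is meaningless. For [phi k], restricted to [[0, 1]], this
    only concerns a countable set. *)
Definition lyapunov_exponent (R : realType) (f rho : R -> R) : \bar R :=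
  (\int[lebesgue_measure]_(x in `[0%R, 1%R]) (rho x * log2 (derive1 f x))%:E)%E.

(* Main.v *)
Require Import Defs.
From HB Require Import structures.
From mathcomp Require Import all_boot all_order all_algebra.
From mathcomp Require Import all_classical all_reals all_analysis.
From mathcomp Require Import measurable_realfun.
From mathcomp Require Import ring lra zify.

(** Let [S] be the map all of whose branches [[2^-i, 2^(1-i)[ -> [0, 1[], with
    [i > 0], are affine and onto; thus [phi 0 = S], and [phi k = S] on
    [[0, 1/2[] for every [k]. Let [D] be the doubling map. If [mu] is the
    measure of density [rho], set [nu = mu] when [k = 0] and otherwise
    [nu A = mu ([0, 1/2[ `&` phi k @^-1` A)]. In the first case [nu] is
    [S]-invariant. In the second one it is [S \o D]-invariant, because up to
    null sets [phi k \o phi k = S \o D] on [[1/2, 1]] and [phi k] maps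
    [[1/2, 1]] into [[0, 1/2[]. Pulling an interval back by [S] or [D] only
    produces shorter intervals, whose relative lengths do not depend on the
    position of the interval. Approximating [rho] in L1 by a continuous density,
    which is almost constant at small scales, and pulling back many times, one
    sees that [nu] gives the same mass to intervals of equal length. This
    determines [mu] on the dyadic intervals, where [log2 (phi k)'] is constant,
    and the Lyapunov exponent becomes an explicit series. *)

Set Implicit Arguments.
Unset Strict Implicit.
Unset Printing Implicit Defensive.

Import Order.TTheory GRing.Theory Num.Theory.
Import numFieldNormedType.Exports.
Local Open Scope classical_set_scope.
Local Open Scope ring_scope.

(** * The full-branch map, the doubling map and their preimages of intervals *)

Section dyadic_maps.
Context {R : realType}.
Implicit Types (x y : R) (i k : nat) (A : set R).

Lemma exprVn2S i : 2 ^- i = 2 * 2 ^- i.+1 :> R.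
Proof. by rewrite exprS invfM mulrA divff ?mul1r. Qed.

Lemma exprVn2_gt0 i : 0 < 2 ^- i :> R.
Proof. by rewrite invr_gt0 exprn_gt0. Qed.

Lemma exprVn2_le1 i : 2 ^- i <= 1 :> R.
Proof. by rewrite invf_le1 ?exprn_gt0// exprn_ege1// ler1n. Qed.

Lemma exprVn2_lt_ex x : 0 < x -> exists n, 2 ^- n < x.
Proof.
move=> x0.
have /cvgrPdist_lt /(_ _ x0) [n _ /(_ n (leqnn n))] :=
  @cvg_geometric R 1 2^-1 ltac:(by rewrite gtr0_norm ?invr_gt0// invf_lt1//
  ltr1n).
by rewrite /= mul1r sub0r normrN exprVn gtr0_norm ?exprVn2_gt0//; exists n.
Qed.

Lemma dyadic_ex x : 0 < x < 1 -> exists i, 2 ^- i.+1 <= x < 2 ^- i.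
Proof.
move=> /andP[x0 x1]; have exn : exists n, 2 ^- n <= x.
  by have [n /ltW nx] := exprVn2_lt_ex x0; exists n.
case: (ex_minnP exn) => -[|i] ix min.
  by move: ix x1; rewrite expr0 invr1 leNgt => /negbTE ->.
exists i; rewrite ix ltNge; apply/negP => /min.
by rewrite ltnn.
Qed.

(** The value [-1] makes [fullbranch @^-1` A] a subset of [`]0, 1[] whenever
    [A] is a subset of [`[0, 1[]. *)
Definition fullbranch x : R := if 0 < x < 1 then phi 0 x else -1.

Lemma fullbranchE i x : 2 ^- i.+1 <= x < 2 ^- i ->
  fullbranch x = 2 ^+ i.+1 * x - 1.
Proof.
move=> /andP[ix xi]; rewrite /fullbranch.
have x0 : 0 < x by rewrite (lt_le_trans _ ix)// exprVn2_gt0.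
have x1 : x < 1 by rewrite (lt_le_trans xi)// exprVn2_le1.
rewrite x0 x1 /=; case: i ix xi => [|i] ix xi.
  by rewrite phi_right ?expr0 ?expr1 ?divr1; lra.
rewrite (@phi_dyadic _ _ i.+2)// ?subn1 ?ix// mulrBr mulfV//.
Qed.

Lemma fullbranch_ge0 x : 0 <= fullbranch x -> 0 < x < 1.
Proof. by rewrite /fullbranch; case: ifP => // _; rewrite ler0N1. Qed.

Lemma fullbranch_range x : 0 < x < 1 -> 0 <= fullbranch x < 1.
Proof.
move=> /dyadic_ex[i ix]; rewrite (@fullbranchE i)//; move: ix.
rewrite (exprVn2S i); have := exprVn2_gt0 i.+1.
set w := 2 ^- i.+1 => w0.
rewrite -[2 ^+ _]invrK -/w subr_ge0 ltrBlDr => /andP[wx xw].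
by rewrite ![w^-1 * _]mulrC ler_pdivlMr// mul1r wx ltr_pdivrMr// xw.
Qed.

(** Doubling carries each dyadic interval onto the next one, and all branches are onto the same
    interval, so consecutive branches differ only by the factor 2. *)
Lemma fullbranch_double x : 0 < x < 2^-1 -> fullbranch (2 * x) = fullbranch x.
Proof.
move=> x01; have /dyadic_ex[i ix] : 0 < 2 * x < 1 by lra.
rewrite (@fullbranchE i)// (@fullbranchE i.+1)//.
  by rewrite [2 ^+ i.+2]exprSr mulrA.
by move: ix; rewrite (exprVn2S i) (exprVn2S i.+1); lra.
Qed.

Lemma fullbranch_halve i x : 0 < x < 1 ->
  fullbranch (2 ^- i * x) = fullbranch x.
Proof.
move=> x01; elim: i => [|i <-]; first by rewrite expr0 invr1 mul1r.
rewrite -fullbranch_double; first by rewrite mulrA -exprVn2S.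
have := exprVn2_gt0 i.+1; have := exprVn2_le1 i; rewrite exprVn2S.
by move=> ? ?; nra.
Qed.

Lemma phi_lt_half k x : 0 < x < 2^-1 -> phi k x = fullbranch x.
Proof.
move=> /andP[x0 x2]; rewrite /fullbranch /phi x0 leNgt x2 /=.
by rewrite (lt_trans x2) ?invf_lt1 ?ltr1n.
Qed.

(** This is [D]. Extending the two affine pieces to all of [R], instead of reducing mod 1, keeps the
    preimage of [[0, 1[] inside [[0, 1[]. *)
Definition doubling x : R := if x < 2^-1 then 2 * x else 2 * x - 1.

Lemma trivIset_dyadic : trivIset setT (fun i =>
  `[2 ^- i.+1, 2 ^- i[%classic : set R).
Proof.
have H i j : (i < j)%N -> 2 ^- j <= 2 ^- i.+1 :> R.
  by move=> ij; rewrite lef_pV2 ?posrE ?exprn_gt0// ler_weXn2l// ler1n.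
apply/trivIsetP => i j _ _; rewrite neq_ltn =>
  /orP[]ij; apply/seteqP; split => // x [] /=; rewrite !in_itv/= =>
  /andP[ix xi] /andP[jx xj];
  by have := H _ _ ij; lra.
Qed.

Lemma bigcup_dyadic : \bigcup_i (`[2 ^- i.+1, 2 ^- i[%classic :
  set R) = `]0, 1[%classic.
Proof.
apply/seteqP; split => x /=; last by rewrite in_itv =>
  /dyadic_ex[i ix]; exists i => //=; rewrite in_itv.
move=> [i _] /=; rewrite !in_itv/=; have := exprVn2_gt0 i.+1; have :=
  exprVn2_le1 i; lra.
Qed.

Lemma measurable_fullbranch : measurable_fun setT fullbranch.
Proof.
have -> : [set: R] = `]0, 1[ `|` ~` `]0, 1[ by rewrite setUv.
apply/measurable_funU; [exact: measurable_itv|apply: measurableC;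
  exact: measurable_itv|split].
  rewrite -bigcup_dyadic; apply/measurable_fun_bigcup =>
    [i|i]; first exact: measurable_itv.
  apply: (eq_measurable_fun (fun x => 2 ^+ i.+1 * x - 1)).
    by move=> x; rewrite inE/= in_itv/= => ix; rewrite (@fullbranchE i).
  by apply: measurable_funB => //; apply: measurable_funM.
apply: (eq_measurable_fun (cst (-1 : R))) => // x; rewrite inE/= in_itv/= =>
  /negP/negbTE x01.
by rewrite /fullbranch x01.
Qed.

Lemma measurable_doubling : measurable_fun setT doubling.
Proof.
apply: measurable_fun_ifT.
- exact: measurable_fun_ltr.
- exact: measurable_funM.
- by apply: measurable_funB => //; apply: measurable_funM.
Qed.

(** Each branch contributes one interval, scaled by [2 ^- i.+1]. The bounds on [a] and [a + l] keep
    the [i]-th piece within the domain of the [i]-th branch. *)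
Lemma preimage_fullbranch_itv a l : 0 <= a -> a + l <= 1 ->
  fullbranch @^-1` `[a, a + l[ =
  \bigcup_i `[2 ^- i.+1 * (a + 1), 2 ^- i.+1 * (a + 1) + 2 ^- i.+1 * l[%classic.
Proof.
move=> a0 al1.
have E i x : (2 ^- i.+1 * (a + 1) <= x < 2 ^- i.+1 * (a + 1) + 2 ^- i.+1 * l) =
             (a <= 2 ^+ i.+1 * x - 1 < a + l).
  have -> : 2 ^+ i.+1 * x = x / 2 ^- i.+1 by rewrite invrK mulrC.
  rewrite lerBrDr ltrBlDr ler_pdivlMr ?exprVn2_gt0// ltr_pdivrMr ?exprVn2_gt0//.
  by rewrite -mulrDr addrAC ![2 ^- _ * _]mulrC.
apply/seteqP; split => x /=; rewrite ?in_itv/=.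
  move=> /andP[aS Sl]; have := fullbranch_ge0 (le_trans a0 aS).
  move=> /dyadic_ex[i ix]; exists i => //=; rewrite in_itv/= E.
  by rewrite -fullbranchE// aS Sl.
move=> [i _] /=; rewrite in_itv/= => xi.
rewrite (@fullbranchE i) -?E//; move: xi; rewrite (exprVn2S i).
by have := exprVn2_gt0 i.+1; nra.
Qed.

Lemma preimage_doubling_itv a l : 0 <= a -> a + l <= 1 ->
  doubling @^-1` `[a, a + l[ =
  `[2^-1 * a, 2^-1 * a + 2^-1 * l[ `|` `[2^-1 * (a + 1), 2^-1 * (a + 1) + 2^-1 *
    l[.
Proof.
move=> a0 al1; apply/seteqP; split => x /=; rewrite !in_itv/= /doubling.
  by case: ltP => x2 xa; [left|right]; lra.
by case=> xa; case: ltP => x2; lra.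
Qed.

Lemma preimage_double_itv a l :
  *%R (2:R) @^-1` `[a, a + l[ = `[2^-1 * a, 2^-1 * a + 2^-1 * l[%classic.
Proof. by apply/seteqP; split => x /=; rewrite !in_itv/=; lra. Qed.

End dyadic_maps.

(** * Measures that are almost translation invariant at small scales *)

Section near_uniform.
Context {R : realType}.
Implicit Types (nu : set R -> \bar R) (lam : {measure set R ->
  \bar R}) (f g : R -> R) (d e : R).
Local Open Scope ereal_scope.

(** One inequality is enough, since [a] and [b] can be exchanged. *)
Definition near_uniform nu d e := forall a b l : R,
  (0 <= a)%R -> (0 <= b)%R -> (0 <= l)%R -> (a + l <= 1)%R -> (b + l <= 1)%R ->
  (`|a - b| + l <= d)%R ->
  nu `[a, (a + l)%R[%classic <= nu `[b, (b + l)%R[%classic + (e * l)%:E.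

(** The pull-back [f @^-1` A] of an interval [A] is a union of intervals at most
    half as long as [A], whence the factor [2]. *)
Definition spreading f := [/\ measurable_fun setT f,
  f @^-1` `[0%R, 1%R[%classic `<=` `[0%R, 1%R[ &
  forall lam d e, (0 <= e)%R -> near_uniform lam d e ->
    near_uniform (pushforward lam f) (2 * d) e].

(** The closeness to [lam] is uniform in [A], so that it survives any pull-back without loss. The
    same [e] also bounds the defect of uniformity of [lam]. *)
Definition approximable nu d e := exists2 lam : {measure set R -> \bar R},
  near_uniform lam d e &
  forall A : set R, measurable A -> A `<=` `[0%R, 1%R[ ->
    nu A <= lam A + e%:E /\ lam A <= nu A + e%:E.

(** [near_uniform] and the measure lemmas are stated for bundled measures; the equation of set
    functions allows passing to the plain pushforward by rewriting. *)
Lemma pushforward_measure_ex lam f : measurable_fun setT f ->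
  exists lam' : {measure set R -> \bar R},
    lam' = pushforward lam f :> (set R -> \bar R).
Proof. by move=> mf; unshelve eexists (pushforward lam f). Qed.

Lemma measurable_preimage f (A : set R) : measurable_fun setT f ->
  measurable A -> measurable (f @^-1` A).
Proof. by move=> mf mA; rewrite -[X in measurable X]setTI; exact: mf. Qed.

Lemma near_uniformS nu d d' e : (d' <= d)%R ->
  near_uniform nu d e -> near_uniform nu d' e.
Proof.
move=> dd H a b l a0 b0 l0 al bl abl; apply: (H a b l a0 b0 l0 al bl).
exact: le_trans abl dd.
Qed.

Lemma spreading_comp f g : spreading f -> spreading g -> spreading (f \o g).
Proof.
move=> [mf f01 Hf] [mg g01 Hg]; split.
- exact: measurableT_comp.
- by rewrite comp_preimage; apply: subset_trans (preimage_subset f01) g01.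
- move=> lam d e e0 lamd.
  have [lam' lam'E] := pushforward_measure_ex lam mg.
  have := Hf lam' (2 * d)%R e e0; rewrite lam'E => /(_ (Hg _ _ _ e0 lamd)).
  (* Composing gives the scale [4 * d], which is at least [2 * d] when [d] is nonnegative; for
     negative [d] near uniformity is vacuous. *)
  have [d0|d0] := leP 0%R d; first by apply: near_uniformS; lra.
  move=> _ a b l _ _ l0 _ _ abl; exfalso.
  by have := normr_ge0 (a - b)%R; lra.
Qed.

Lemma approximable_pushforward nu f d e : spreading f -> (0 <= e)%R ->
  approximable nu d e -> approximable (pushforward nu f) (2 * d) e.
Proof.
move=> [mf f01 Hf] e0 [lam lamd nulam].
have [lam' lam'E] := pushforward_measure_ex lam mf.
exists lam'; first by rewrite lam'E; exact: Hf.
move=> A mA A01; rewrite lam'E /pushforward; apply: nulam.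
  exact: measurable_preimage.
exact: subset_trans (preimage_subset A01) f01.
Qed.

Lemma spreading_double : spreading ( *%R 2%R).
Proof.
split.
- exact: mulrl_measurable.
- by move=> x /=; rewrite !in_itv/=; lra.
- move=> lam d e e0 lamd a b l a0 b0 l0 al bl abl.
  rewrite /pushforward !preimage_double_itv.
  have ab : (`|2^-1 * a - 2^-1 * b| = 2^-1 * `|a - b|)%R.
    by rewrite -mulrBr normrM ger0_norm.
  apply: (le_trans (lamd (2^-1 * a)%R (2^-1 * b)%R (2^-1 * l)%R _ _ _ _ _ _));
    [lra|lra|lra|lra|lra|by rewrite ab; lra|].
  by rewrite leeD2l// lee_fin ler_wpM2l//; lra.
Qed.

Lemma spreading_doubling : spreading (@doubling R).
Proof.
split.
- exact: measurable_doubling.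
- by move=> x /=; rewrite !in_itv/= /doubling; case: ltP => ?; lra.
- move=> lam d e e0 lamd a b l a0 b0 l0 al bl abl.
  rewrite /pushforward !preimage_doubling_itv//.
  have disj (c : R) : (c + l <= 1)%R -> (0 <= c)%R ->
      `[(2^-1 * c)%R, (2^-1 * c + 2^-1 * l)%R[ `&`
      `[(2^-1 * (c + 1))%R, (2^-1 * (c + 1) + 2^-1 * l)%R[ = set0 :> set R.
    by move=> cl c0; apply/seteqP; split => // x [] /=; rewrite !in_itv/=; lra.
  rewrite !measureU ?disj//.
  have ab (c : R) : (`|2^-1 * (a + c) - 2^-1 * (b + c)| = 2^-1 * `|a - b|)%R.
    by rewrite -mulrBr normrM ger0_norm// opprD addrACA subrr addr0.
  have -> : (e * l)%:E = (e * (2^-1 * l))%:E + (e * (2^-1 * l))%:E.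
    by rewrite -EFinD; congr _%:E; lra.
  rewrite addeACA leeD//; apply: lamd; try lra.
  - by have := ab 0%R; rewrite !addr0 => ->; lra.
  - by rewrite ab; lra.
Qed.

Lemma spreading_fullbranch : spreading (@fullbranch R).
Proof.
split.
- exact: measurable_fullbranch.
- by move=> x /=; rewrite !in_itv/= => /andP[/fullbranch_ge0/andP[/ltW-> ->]].
- move=> lam d e e0 lamd a b l a0 b0 l0 al bl abl.
  rewrite /pushforward !preimage_fullbranch_itv//.
  pose J (c : R) i : set R :=
    `[(2 ^- i.+1 * (c + 1))%R,
      (2 ^- i.+1 * (c + 1) + 2 ^- i.+1 * l)%R[%classic.
  have JE (c : R) : (0 <= c)%R -> (c + l <= 1)%R ->
      lam (\bigcup_i J c i) = \sum_(i <oo) lam (J c i).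
    move=> c0 cl; rewrite measure_semi_bigcup//; last 2 first.
    - apply/trivIsetP => i j _ _ ij.
      have JS k : J c k `<=` `[(2 ^- k.+1)%R, (2 ^- k)%R[.
        move=> x; rewrite /J /= !in_itv/= (exprVn2S k).
        by have := @exprVn2_gt0 R k.+1; nra.
      apply: subsetI_eq0 (JS i) (JS j) _.
      by move/trivIsetP : (@trivIset_dyadic R); apply.
    - by apply: bigcup_measurable => i _; exact: measurable_itv.
    by move=> i; exact: measurable_itv.
  rewrite !JE//.
  (* The error is distributed geometrically: the [i]-th piece has length [2 ^- i.+1 * l], and these
     lengths add up to [l]. *)
  have -> : (e * l)%:E = \sum_(i <oo) (e * l / (2 ^ (i + 1))%:R)%:E.
    have /cvg_lim := @cvg_geometric_eseries_half R (e * l) 0.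
    by rewrite expr0 divr1 => ->.
  have el0 i : (0 <= e * l / (2 ^ (i + 1))%:R)%R by rewrite divr_ge0// mulr_ge0.
  rewrite -nneseriesD//; last by move=> i _ _; rewrite lee_fin.
  apply: lee_nneseries => // i _.
  have w0 := @exprVn2_gt0 R i.+1.
  have w1 : (2 ^- i.+1 <= 2^-1 :> R)%R.
    by have := @exprVn2_le1 R i; rewrite exprVn2S; lra.
  rewrite addn1 natrX mulrAC -mulrA.
  apply: lamd; try nra.
  rewrite -mulrBr normrM (ger0_norm (ltW w0)) opprD addrACA subrr addr0.
  by have := normr_ge0 (a - b)%R; nra.
Qed.

(** Pulling back by [f] leaves [nu] unchanged but doubles the scale at which its approximation is
    near uniform. Once that scale exceeds 1 it covers every pair of intervals of equal length in
    [[0, 1]], and then [e] tends to 0. *)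
Lemma approximable_uniform nu f : spreading f ->
  (forall A : set R, measurable A -> A `<=` `[0%R, 1%R[ ->
    nu (f @^-1` A) = nu A) ->
  (forall e, (0 < e)%R -> exists2 d, (0 < d)%R & approximable nu d e) ->
  near_uniform nu 1 0.
Proof.
move=> sf nuf nua a b l a0 b0 l0 al bl abl; rewrite mul0r adde0.
apply/lee_addgt0Pr => e e0.
(* Three errors occur: replacing [nu] by [lam] on each of the two intervals, and comparing the two
   intervals under [lam], where [l <= 1]. *)
have e30 : (0 < e / 3)%R by rewrite divr_gt0.
have [d d0 nud] := nua _ e30.
have {nud} nud n : approximable nu (2 ^+ n * d) (e / 3).
  elim: n => [|n]; first by rewrite expr0 mul1r.
  move=> /(approximable_pushforward sf (ltW e30)) [lam lamd nulam].
  exists lam; first by rewrite exprS -mulrA.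
  by move=> A mA A01; rewrite -(nuf A)//; exact: nulam.
have [n nd] := exprVn2_lt_ex d0.
have [lam lamd nulam] := nud n.
have sub01 (c : R) : (0 <= c)%R -> (c + l <= 1)%R ->
  `[c, (c + l)%R[%classic `<=` `[0%R, 1%R[.
  by move=> c0 cl x /=; rewrite !in_itv/=; lra.
have l1 : (l <= 1)%R by lra.
have [+ _] := nulam _ (measurable_itv `[a, (a + l)%R[) (sub01 _ a0 al).
move=> /le_trans; apply.
have [_] := nulam _ (measurable_itv `[b, (b + l)%R[) (sub01 _ b0 bl).
move=> /(leeD2r (e / 3 + e / 3)%:E) lamb.
apply: (@le_trans _ _ (lam `[b, (b + l)%R[%classic + (e / 3 + e / 3)%:E));
  last first.
  apply: (le_trans lamb); rewrite -addeA -EFinD.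
  by have -> : (e / 3 + (e / 3 + e / 3) = e)%R by lra.
rewrite [X in _ <= _ + X]EFinD addeA leeD2r//.
apply: (le_trans (lamd _ _ _ a0 b0 l0 al bl _)); last first.
  by rewrite leeD2l// lee_fin ler_piMr// ltW.
apply: le_trans abl _.
by rewrite -ler_pdivrMl ?exprn_gt0// mulr1 ltW.
Qed.

(** Intervals of equal length have equal mass, so bisecting [[0, 1[] repeatedly halves the mass at
    each stage. *)
Lemma near_uniform_dyadic lam n (a : R) : near_uniform lam 1 0 ->
  (0 <= a)%R -> (a + 2 ^- n <= 1)%R ->
  lam `[a, (a + 2 ^- n)%R[%classic = (2 ^- n)%:E * lam `[0%R, 1%R[%classic.
Proof.
move=> lamu a0 al.
have le_shift (b c l : R) : (0 <= b)%R -> (0 <= c)%R -> (0 <= l)%R ->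
    (b + l <= 1)%R -> (c + l <= 1)%R ->
    lam `[b, (b + l)%R[%classic <= lam `[c, (c + l)%R[%classic.
  move=> b0 c0 l0 bl cl; have := lamu b c l; rewrite mul0r adde0; apply => //.
  by rewrite -lerBrDr ler_norml; lra.
have shift (b c l : R) : (0 <= b)%R -> (0 <= c)%R -> (0 <= l)%R ->
    (b + l <= 1)%R -> (c + l <= 1)%R ->
    lam `[b, (b + l)%R[%classic = lam `[c, (c + l)%R[%classic.
  by move=> *; apply/eqP; rewrite eq_le !le_shift.
have w0 i := @exprVn2_gt0 R i; have w1 i := @exprVn2_le1 R i.
rewrite (shift a 0%R) ?add0r// ?ltW//.
elim: n {a a0 al} => [|n IH]; first by rewrite expr0 invr1 mul1e.
have H : lam `[0%R, (2 ^- n)%R[%classic =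
    lam `[0%R, (2 ^- n.+1)%R[%classic + lam `[0%R, (2 ^- n.+1)%R[%classic.
  have wn := w0 n.+1; have wn1 := w1 n; rewrite (exprVn2S n) in wn1.
  have /= := shift 0%R (2 ^- n.+1)%R (2 ^- n.+1)%R.
  rewrite add0r => E; rewrite {2}E; [|lra..].
  rewrite -measureU//.
    congr (lam _); apply/seteqP; split => x /=; rewrite !in_itv/= (exprVn2S n).
      by case: (ltP x (2 ^- n.+1)%R) => ? ?; [left|right]; lra.
    by have := w0 n.+1; case; lra.
  by apply/seteqP; split => x []//=; rewrite !in_itv/=; lra.
set X := lam `[0%R, (2 ^- n.+1)%R[%classic in H *.
have X0 : 0 <= X by exact: measure_ge0.
have -> : (2 ^- n.+1 = 2^-1 * 2 ^- n :> R)%R by rewrite (exprVn2S n); lra.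
rewrite EFinM -muleA -IH H ge0_muleDr//.
by rewrite -ge0_muleDl ?lee_fin ?invr_ge0// -EFinD -div1r -splitr mul1e.
Qed.

End near_uniform.

(** * The measure with a given density on the unit interval *)

Section restricted_density.
Context {R : realType}.
Variable f : R -> R.
Hypothesis mf : measurable_fun (`[0, 1]%classic : set R) f.
Hypothesis f0 : forall x : R, 0 <= x <= 1 -> 0 <= f x.

(** The density is controlled only on [[0, 1]]; intersecting with it yields a measure on all Borel
    subsets of [R]. *)
Definition restricted_density (A : set R) : \bar R :=
  density_measure f (A `&` `[0, 1]).

Let dens0 : restricted_density set0 = 0%E.
Proof. by rewrite /restricted_density set0I /density_measure integral_set0. Qed.

Let dens_ge0 A : (0 <= restricted_density A)%E.
Proof. by apply: integral_ge0 => x [_ /=]; rewrite in_itv/= lee_fin => /f0. Qed.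

Let dens_sigma_additive : semi_sigma_additive restricted_density.
Proof.
move=> /= F mF tF mUF; rewrite /restricted_density /density_measure.
apply: cvg_toP.
  apply: ereal_nondecreasing_is_cvgn => m n mn.
  by apply: lee_sum_nneg_natr => // k _ _; exact: dens_ge0.
rewrite setI_bigcupl ge0_integral_bigcup//=.
- by move=> k; apply: measurableI; [exact: mF|exact: measurable_itv].
- rewrite -setI_bigcupl; apply/measurable_EFinP.
  by apply: measurable_funS mf => //; exact: subIsetr.
- by move=> x [n _ [_ /=]]; rewrite in_itv/= lee_fin => /f0.
- by apply/trivIsetP => i j _ _ ij;
    apply: subsetI_eq0 (@subIsetl _ _ _) (@subIsetl _ _ _) _;
    move/trivIsetP : tF; apply.
Qed.

HB.instance Definition _ := isMeasure.Build _ _ _ restricted_density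
  dens0 dens_ge0 dens_sigma_additive.

Lemma restricted_density_measure : exists mu : {measure set R -> \bar R},
  mu = restricted_density :> (set R -> \bar R).
Proof. by exists restricted_density. Qed.

End restricted_density.

(** * Approximation of a density in L1 by a continuous one *)

Section approximation.
Context {R : realType}.
Implicit Types (f g h : R -> R).

(** Near each point of the compact interval some radius works for all neighbouring points; the
    near-covering form of compactness yields a common radius. *)
Lemma unif_continuous01 h : continuous h -> forall e : R, 0 < e ->
  exists2 d : R, 0 < d & forall x y : R, 0 <= x <= 1 ->
    `|x - y| <= d -> `|h x - h y| <= e.
Proof.
move=> ch e e0.
have := @segment_compact R 0 1 => /compact_near_coveringP.
move=> /(_ _ (0 : R)^'+ (fun d x : R =>
  forall y, `|x - y| <= d -> `|h x - h y| <= e)).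
have nc (x : R) : `[0, 1]%classic x ->
  \forall x' \near x & i \near (0:R)^'+, forall y, `|x' - y| <= i ->
  `|h x' - h y| <= e.
  move=> _.
  have e20 : 0 < e / 2 by rewrite divr_gt0.
  have /cvgrPdist_lt /(_ _ e20) := ch x.
  rewrite near_nbhs => /nbhs_ballP[r /= r0 Hr].
  (* Halving the radius keeps both [x'] and [y] within [r] of [x], so each value of [h] is within
     [e / 2] of [h x]. *)
  exists (ball x (r / 2), [set i | i < r / 2]) => /=.
    split; first by apply/nbhs_ballP; exists (r / 2) => //=; rewrite divr_gt0.
    by apply: nbhs_right_lt; rewrite divr_gt0.
  move=> [x' i] /= [xx' ir] y x'y.
  have h1 : `|h x - h x'| < e / 2 by apply: Hr; rewrite /ball/= in xx' *; lra.
  have h2 : `|h x - h y| < e / 2.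
    apply: Hr; rewrite /ball/= in xx' *.
    by have := ler_distD x' x y; lra.
  have := ler_distD (h x) (h x') (h y); rewrite (distrC (h x') (h x)); lra.
move=> /(_ _ nc) H.
have [d [d0 Hd]] : exists d : R, 0 < d /\ forall x, `[0, 1]%classic x ->
  forall y, `|x - y| <= d -> `|h x - h y| <= e.
  near (0 : R)^'+ => d; exists d; split => //.
  by near: d; exact: H.
by exists d => // x y x01; apply: Hd.
Unshelve. all: by end_near. Qed.

Lemma lebesgue_measure_co (a l : R) : 0 <= l ->
  lebesgue_measure `[a, a + l[%classic = l%:E.
Proof.
rewrite le_eqVlt => /predU1P[<-|l0].
  by rewrite addr0 lebesgue_measure_itv/= ltxx.
by rewrite lebesgue_measure_itv/= lte_fin ltrDl l0 -EFinB addrAC subrr add0r.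
Qed.

(** Both integrals are compared with [g a * l]. The condition [|a - b| + l <= d] puts all points of
    both intervals within [d] of [a], and each comparison costs [e / 2 * l]. *)
Lemma near_uniform_density g (d e : R) :
  measurable_fun (`[0, 1]%classic : set R) g -> (forall x, 0 <= g x) ->
  0 < e ->
  (forall x y : R, 0 <= x <= 1 -> `|x - y| <= d -> `|g x - g y| <= e / 2) ->
  near_uniform (restricted_density g) d e.
Proof.
move=> mg g0 e0 gd a b l a0 b0 l0 al bl abl.
have sub01 (c : R) : 0 <= c -> c + l <= 1 ->
  `[c, c + l[ `<=` (`[0, 1]%classic : set R).
  by move=> c0 cl x /=; rewrite !in_itv/=; lra.
have a01 : 0 <= a <= 1 by lra.
rewrite /restricted_density /density_measure !setIidl; [|exact: sub01..].
have mEg (c : R) : 0 <= c -> c + l <= 1 ->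
  measurable_fun `[c, c + l[ (EFin \o g).
  move=> c0 cl; apply/measurable_EFinP; apply: measurable_funS mg => //.
  exact: sub01.
apply: (@le_trans _ _ ((g a + e / 2) * l)%:E).
  rewrite EFinM -(lebesgue_measure_co a l0) -integral_cst//.
  apply: ge0_le_integral => //.
  - by move=> x _; rewrite lee_fin.
  - exact: mEg.
  - move=> x /=; rewrite in_itv/= lee_fin => xa.
    have /(gd a x a01) : `|a - x| <= d.
      by rewrite distrC ger0_norm; have := normr_ge0 (a - b); lra.
    by rewrite ler_norml; lra.
have : ((g a * l)%:E <= \int[lebesgue_measure]_(x in `[b, (b + l)%R[) (g x + e /
  2)%:E)%E.
  rewrite EFinM -(lebesgue_measure_co b l0) -integral_cst//.
  apply: ge0_le_integral => //.
  - by move=> x _; rewrite lee_fin.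
  - apply/measurable_EFinP; apply: measurable_funD => //.
    by apply/measurable_EFinP; exact: mEg.
  - move=> x /=; rewrite in_itv/= lee_fin => xb.
    have /(gd a x a01) : `|a - x| <= d.
      apply: le_trans abl; apply: (le_trans (ler_distD b a x)).
      by rewrite lerD2l distrC ger0_norm; lra.
    by rewrite ler_norml; lra.
under eq_integral do rewrite EFinD.
rewrite ge0_integralD//=; last 3 first.
- by move=> x _; rewrite lee_fin.
- exact: mEg.
- by move=> x _; rewrite lee_fin divr_ge0// ltW.
rewrite integral_cst// [X in (_ * X)%E](lebesgue_measure_co b l0) -EFinM =>
  /(leeD2r (e / 2 * l)%:E).
rewrite -EFinD -mulrDl => /le_trans; apply.
by rewrite -addeA leeD2l// -EFinD lee_fin -mulrDl -splitr.
Qed.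

Lemma approximable_density f (e : R) :
  measurable_fun (`[0, 1]%classic : set R) f ->
  (forall x : R, 0 <= x <= 1 -> 0 <= f x) ->
  (density_measure f `[0%R, 1%R] < +oo)%E -> 0 < e ->
  exists2 d, 0 < d & approximable (restricted_density f) d e.
Proof.
move=> mf f0 foo e0.
have intf : lebesgue_measure.-integrable `[0%R, 1%R] (EFin \o f).
  apply/integrableP; split; first exact/measurable_EFinP.
  apply: le_lt_trans foo; rewrite le_eqVlt; apply/predU1P; left;
    apply: eq_integral => x.
  by rewrite inE/= in_itv/= => x01; rewrite ger0_norm// f0.
have fin01 : (lebesgue_measure (`[0%R, 1%R]%classic : set R) < +oo)%E.
  by rewrite lebesgue_measure_itv/= lte_fin ltr01 -EFinB ltry.
have [h_ [ch inth cvgh]] := approximation_continuous_integrable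
  (measurable_itv _) fin01 intf.
have [n fh] : exists n,
    (\int[lebesgue_measure]_(x in `[0%R, 1%R]) `|(f x - h_ n x)%:E| <= e%:E)%E.
  move/fine_cvgP : cvgh => [fhfin /cvgrPdist_le /(_ _ e0) fhe].
  near \oo => n; exists n.
  rewrite -(@fineK _ (\int[_]_(x in _) _)%E); last by near: n.
  rewrite lee_fin -[leLHS]ger0_norm ?fine_ge0 ?integral_ge0// -normrN -sub0r.
  by near: n.
(* The approximant may be negative. Its positive part is a density, and it is no farther from the
   nonnegative [f]. *)
pose g x := Num.max (h_ n x) 0.
have mh : measurable_fun (`[0, 1]%classic : set R) (h_ n).
  by have /integrableP[/measurable_EFinP] := inth n.
have mg : measurable_fun (`[0, 1]%classic : set R) g by exact: measurable_maxr.
have g0 x : 0 <= g x by rewrite le_max lexx orbT.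
have e20 : 0 < e / 2 by rewrite divr_gt0.
have [d d0 hd] := unif_continuous01 (ch n) e20.
have [lam lamE] := restricted_density_measure mg (fun x _ => g0 x).
exists d => //; exists lam.
  rewrite lamE; apply: near_uniform_density => // x y x01 /(hd _ _ x01).
  rewrite /g !ler_norml.
  by case: (leP (h_ n x) 0) => ?; case: (leP (h_ n y) 0) => ?; lra.
(* Used in both directions, with [f] and [g] in either role; the error over [A] is at most the L1
   distance over [[0, 1]]. *)
have triangle (u v : R -> R) (A : set R) : measurable A -> A `<=` `[0%R, 1%R] ->
    measurable_fun (`[0, 1]%classic : set R) u ->
    measurable_fun (`[0, 1]%classic : set R) v ->
    (forall x, 0 <= x <= 1 -> 0 <= u x) -> (forall x, 0 <= x <= 1 ->
      0 <= v x) ->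
    (forall x, 0 <= x <= 1 -> u x <= v x + `|f x - h_ n x|) ->
    (density_measure u A <= density_measure v A + e%:E)%E.
  move=> mA A01 mu mv u0 v0 uv.
  have Ax x : A x -> 0 <= x <= 1 by move=> /A01 /=; rewrite in_itv.
  apply: (@le_trans _ _ (density_measure v A +
      \int[lebesgue_measure]_(x in A) `|(f x - h_ n x)%:E|)%E).
    have mE (w : R -> R) : measurable_fun (`[0, 1]%classic : set R) w ->
      measurable_fun A (EFin \o w).
      by move=> mw; apply/measurable_EFinP; exact: measurable_funS mw.
    have mfh : measurable_fun A (fun x => `|(f x - h_ n x)%:E|%E).
      apply: measurableT_comp => //; apply: mE; exact: measurable_funB.
    rewrite -ge0_integralD//; [|by move=> x /Ax/v0; rewrite lee_fin|exact: mE].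
    apply: ge0_le_integral => //.
    - by move=> x /Ax/u0; rewrite lee_fin.
    - exact: mE.
    - by apply: emeasurable_funD => //; exact: mE.
    - by move=> x /Ax /uv; rewrite -lee_fin EFinD.
  rewrite leeD2l//; apply: le_trans fh; apply: ge0_subset_integral => //.
  apply: measurableT_comp => //; apply/measurable_EFinP; exact: measurable_funB.
move=> A mA A01; have {}A01 : A `<=` `[0%R, 1%R].
  by apply: subset_trans A01 _ => x /=; rewrite !in_itv/=; lra.
rewrite lamE /restricted_density setIidl//; split; apply: triangle => // x x01.
  rewrite /g; have := ler_norm (f x - h_ n x).
  by case: (leP (h_ n x) 0) => ?; lra.
have fx0 := f0 _ x01.
rewrite /g; have := ler_norm (- (f x - h_ n x)); rewrite normrN.
by have := normr_ge0 (f x - h_ n x); case: (leP (h_ n x) 0) => ?; lra.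
Unshelve. all: by end_near. Qed.

End approximation.

(** * Measures invariant under [phi k] and their values on dyadic intervals *)

Lemma measure_eq_mod d (T : measurableType d) (R : realFieldType)
    (mu : {measure set T -> \bar R}) (A B N : set T) :
  measurable A -> measurable B -> measurable N -> mu N = 0%E ->
  A `<=` B `|` N -> B `<=` A `|` N -> mu A = mu B.
Proof.
move=> mA mB mN N0 AB BA; apply/eqP; rewrite eq_le; apply/andP; split.
- by rewrite -(measureU0 mB mN N0) le_measure ?inE//; exact: measurableU.
- by rewrite -(measureU0 mA mN N0) le_measure ?inE//; exact: measurableU.
Qed.

Section invariant_measure.
Context {R : realType}.
Variables (k : nat) (mu : {measure set R -> \bar R}).
Hypothesis mu_itv01 : mu `[0, 1]%classic = 1%E.
Hypothesis mu_point : forall x : R, mu [set x] = 0%E.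
Hypothesis mu_approx : forall e : R, 0 < e ->
  exists2 d : R, 0 < d & approximable mu d e.
Hypothesis mu_invariant : forall A : set R, measurable A -> A `<=` `[0, 1] ->
  mu (`[0, 1] `&` phi k @^-1` A) = mu A.

(** Rewriting the dyadic part as [fullbranch] avoids arguing about the choice made in
    [dyadic_index]. *)
Lemma measurable_phi : measurable_fun setT (@phi R k).
Proof.
have -> : @phi R k = fun x =>
  if (2^-1 <= x) && (x <= 1) then 2 / 2 ^+ k * (x - 2^-1)
    else if (0 < x) && (x < 2^-1) then fullbranch x else 0.
  apply/funext => x; case: (boolP ((2^-1 <= x) && (x <= 1))) => [x2|nx2].
    exact: phi_right.
  case: ifPn => [/phi_lt_half -> //|nx0].
  by rewrite /phi (negbTE nx2) (negbTE nx0).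
apply: measurable_fun_ifT.
- by apply: measurable_and; exact: measurable_fun_ler.
- apply: measurable_funM => //; exact: measurable_funB.
- apply: measurable_fun_ifT => //; last exact: measurable_fullbranch.
  by apply: measurable_and; exact: measurable_fun_ltr.
Qed.

(** The formulas for [phi k] in terms of [fullbranch] may fail on [N]. *)
Let N : set R := [set 0; 2^-1; 1].

Let mN : measurable N.
Proof. by apply: measurableU => //; apply: measurableU. Qed.

Let N0 : mu N = 0%E.
Proof. by rewrite /N !measureU0 ?mu_point//; apply: measurableU. Qed.

(** For [A] in [[0, 1[] this is the [mu]-mass of the part of the preimage under [phi k] in the left
    half: precomposing with doubling does not change [fullbranch] there, and excludes the right
    half. Being a pushforward by a spreading map, it inherits approximability from [mu]. *)
Let left_measure : set R -> \bar R := pushforward mu (fullbranch \o *%R 2).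
Let right_measure (A : set R) : \bar R := mu (`[2^-1, 1] `&` phi k @^-1` A).

Let mright (A : set R) : measurable A ->
  measurable (`[2^-1, 1] `&` phi k @^-1` A).
Proof.
by move=> mA; apply: measurableI => //; apply: measurable_preimage =>
  //; exact: measurable_phi.
Qed.

Let spreading_left : spreading ((@fullbranch R) \o *%R 2).
Proof. exact: spreading_comp spreading_fullbranch spreading_double. Qed.

Let mleft (A : set R) : measurable A ->
  measurable ((fullbranch \o *%R 2) @^-1` A).
Proof. by move=> mA; apply: measurable_preimage =>
  //; case: spreading_left. Qed.

Let left_pre (A : set R) (x : R) : A `<=` `[0, 1[ ->
  ((fullbranch \o *%R 2) @^-1` A) x ->
  0 < x < 2^-1 /\ A (fullbranch x).
Proof.
move=> A01 /= Ax; have := A01 _ Ax; rewrite /= in_itv/= =>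
  /andP[/fullbranch_ge0 x01 _].
have x02 : 0 < x < 2^-1 by lra.
by rewrite -fullbranch_double.
Qed.

(** Invariance replaces [A] by its preimage, which is cut at [2^-1]; the points of [N] are
    negligible. *)
Let mu_split (A : set R) : measurable A -> A `<=` `[0, 1[ ->
  mu A = (left_measure A + right_measure A)%E.
Proof.
move=> mA A01.
have A01' : A `<=` `[0, 1].
  by apply: subset_trans A01 _ => x /=; rewrite !in_itv/=; lra.
rewrite -mu_invariant// /left_measure /right_measure /pushforward -measureU.
- apply: (measure_eq_mod _ _ mN N0).
  + by apply: measurableI => //; apply: measurable_preimage =>
      //; exact: measurable_phi.
  + by apply: measurableU; [exact: mleft|exact: mright].
  + move=> x [/=]; rewrite in_itv/= => x01 Ax.
    have [->|x0] := eqVneq x 0; first by right; left; left.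
    left; case: (leP 2^-1 x) => x2.
      by right; split => //=; rewrite in_itv/= x2; case/andP: x01.
    have x02 : 0 < x < 2^-1 by rewrite x2 andbT lt_neqAle eq_sym x0;
      case/andP: x01.
    by left => /=; rewrite fullbranch_double// -(phi_lt_half k).
  + move=> x [/left_pre[]// x0 Ax|[/=]]; left; split =>
      //=; rewrite ?phi_lt_half ?in_itv//=; first lra.
    by move: a; rewrite in_itv/=; lra.
- exact: mleft.
- exact: mright.
- apply/seteqP; split => // x [/left_pre[]// x0 _ [/= ]]; rewrite in_itv/=; lra.
Qed.

Let fin_mu (A : set R) : measurable A -> A `<=` `[0, 1] -> mu A \is a fin_num.
Proof.
move=> mA A01; rewrite ge0_fin_numE//; apply: (@le_lt_trans _ _ 1%E);
  last exact: ltry.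
by rewrite -mu_itv01 le_measure ?inE.
Qed.

Let phi_rightE (x : R) : 2^-1 <= x <= 1 -> phi k x = 2 ^- k * (2 * x - 1).
Proof. by move=> x01; rewrite phi_right//; lra. Qed.

(** On [[2^-1, 1]] the values of [phi k] are at most [2 ^- k], attained only at 1. *)
Let right_eq0 (A : set R) : measurable A -> A `<=` `[2 ^- k, +oo[ ->
  right_measure A = 0%E.
Proof.
move=> mA Ak; apply: subset_measure0 N0; [exact: mright|exact: mN|].
move=> x [/=]; rewrite in_itv/= =>
  x01 /Ak /=; rewrite in_itv/= andbT phi_rightE//.
have := @exprVn2_gt0 R k => w0 wx; right; apply/eqP; rewrite eq_le; apply/andP;
  split; first lra.
rewrite -(ler_pM2l w0) mulr1; nra.
Qed.

Let right_sub (A : set R) : `[2^-1, 1] `&` A `<=` `[0, 1].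
Proof. by move=> x [/=]; rewrite !in_itv/=; lra. Qed.

(** Let [B] be the preimage of [A]. By [mu_split], the left mass of [B] is [mu B] minus its right
    mass. Up to null sets, the right mass is the [mu]-mass of [B] within [[2^-1, 1]], because [step]
    makes membership in [B] invariant under [phi k] there. What remains is the part of [B] in the
    left half, whose mass is the left mass of [A]. *)
Let left_invariant (A : set R) : (0 < k)%N -> measurable A -> A `<=` `[0, 1[ ->
  left_measure ((fullbranch \o doubling) @^-1` A) = left_measure A.
Proof.
move=> k0 mA A01; set B := _ @^-1` A.
have [mT T01 _] := spreading_comp (@spreading_fullbranch R) (@spreading_doubling
  R).
have mB : measurable B by exact: measurable_preimage.
have B01 : B `<=` `[0, 1[ by exact: subset_trans (preimage_subset A01) T01.
have mBr : measurable (`[2^-1, 1] `&` B) by exact: measurableI.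
have -> : left_measure B = (mu B - right_measure B)%E.
  by rewrite (mu_split mB B01) addeK// (fin_mu (mright mB))//; exact: right_sub.
(* As [k] is positive, [phi k x] lies below [2^-1], so doubling only multiplies it by 2. The result
   is [2 * x - 1] times a power of [2^-1], which [fullbranch] ignores. *)
have step (x : R) : 2^-1 < x < 1 ->
    fullbranch (doubling (phi k x)) = fullbranch (doubling x).
  move=> x01; rewrite phi_rightE; last by lra.
  have kE : 2 ^- k = 2^-1 * 2 ^- k.-1 :> R.
    by rewrite -[in LHS](prednK k0) (exprVn2S k.-1); lra.
  have w0 := @exprVn2_gt0 R k.-1; have w1 := @exprVn2_le1 R k.-1.
  have y2 : 2 ^- k * (2 * x - 1) < 2^-1 by rewrite kE; nra.
  rewrite /doubling y2 ltNge ltW/=; last by case/andP: x01.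
  have -> : 2 * (2 ^- k * (2 * x - 1)) = 2 ^- k.-1 * (2 * x - 1) :> R.
    by rewrite kE !mulrA mulfV// mul1r.
  by rewrite fullbranch_halve//; lra.
have -> : right_measure B = mu (`[2^-1, 1] `&` B).
  apply: (measure_eq_mod _ _ mN N0) => //; first exact: mright.
    move=> x [/= x01 Bx]; rewrite in_itv/= in x01.
    have [->|x1] := eqVneq x 1; first by right; right.
    have [->|x2] := eqVneq x 2^-1; first by right; left; right.
    left; split; first by rewrite /= in_itv.
    by rewrite /B/= -step//; rewrite !lt_neqAle x1 eq_sym x2.
  move=> x [/= x01 Bx]; rewrite in_itv/= in x01.
  have [->|x1] := eqVneq x 1; first by right; right.
  have [->|x2] := eqVneq x 2^-1; first by right; left; right.
  left; split; first by rewrite /= in_itv.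
  by rewrite /B/= step//; rewrite !lt_neqAle x1 eq_sym x2.
have -> : mu B = (left_measure A + mu (`[2^-1%R, 1%R] `&` B))%E.
  rewrite /left_measure /pushforward -measureU//; last 2 first.
    - exact: mleft.
    - apply/seteqP; split => // x [/left_pre[]// x0 _ [/= ]]; rewrite in_itv/=;
        lra.
  congr (mu _); apply/seteqP; split => [x Bx|x [Ax|[]//]].
    have := B01 _ Bx; rewrite /= in_itv/= => x01.
    case: (ltP x 2^-1) => x2; last by right; split =>
      //=; rewrite in_itv/=; lra.
    by left; move: Bx; rewrite /B /= /doubling x2.
  have [x0 _] := left_pre A01 Ax.
  rewrite /B/= /doubling ifT//; by lra.
by rewrite addeK// fin_mu.
Qed.

Let mass := mu `]0, 2^-1[%classic.

Let left_dyadic n (a : R) : (0 < k)%N -> 0 <= a -> a + 2 ^- n <= 1 ->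
  left_measure `[a, a + 2 ^- n[%classic = ((2 ^- n)%:E * mass)%E.
Proof.
move=> k0 a0 an.
have [nu nuE] := pushforward_measure_ex mu (let: And3 m _ _ :=
  spreading_left in m).
have E : left_measure `[0, 1[%classic = mass.
  congr (mu _); apply/seteqP; split => x; rewrite /= !in_itv/=.
    by move=> /andP[/fullbranch_ge0]; lra.
  by move=> x0; have /fullbranch_range : 0 < 2 * x < 1 by lra.
rewrite -E -[left_measure]/(pushforward mu _) -nuE;
  apply: near_uniform_dyadic => //.
rewrite nuE; apply: (approximable_uniform (spreading_comp (@spreading_fullbranch
  R) (@spreading_doubling R))).
  by move=> A mA A01; exact: left_invariant.
move=> e e0; have [d d0 dmu] := mu_approx e0.
exists (2 * d); first lra.
by apply: approximable_pushforward => //; exact: ltW.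
Qed.

(** The first term is the left mass, [mass] being [2 / 3]. The second is the right mass, nonzero
    only for intervals below [2 ^- k]; it is the [mu]-mass of an interval in the right half, where
    [mu] is again the left measure. *)
Lemma measure_dyadic_pos i : (0 < k)%N ->
  mu `[2 ^- i.+1, 2 ^- i[%classic =
  (2 / 3 * (2 ^- i.+1 + (if (k <= i)%N then 2 ^+ k * 2 ^- i.+2 else 0)))%:E.
Proof.
move=> k0.
have muL (A : set R) : measurable A -> A `<=` `[0, 1[ ->
  A `<=` `[2 ^- k, +oo[ -> mu A = left_measure A.
  by move=> mA A01 Ak; rewrite mu_split// right_eq0// adde0.
have w0 n := @exprVn2_gt0 R n; have w1 n := @exprVn2_le1 R n.
have wmono m n : (m <= n)%N -> 2 ^- n <= 2 ^- m :> R.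
  by move=> mn; rewrite lef_pV2 ?posrE ?exprn_gt0// ler_weXn2l// ler1n.
have I01 n : `[2 ^- n.+1, 2 ^- n[ `<=` (`[0, 1[ : set R).
  by move=> x /=; rewrite !in_itv/=; have := w0 n.+1; have := w1 n; lra.
have ILeft n : left_measure `[2 ^- n.+1, 2 ^- n[%classic =
  ((2 ^- n.+1)%:E * mass)%E.
  have nn : 2 ^- n.+1 + 2 ^- n.+1 = 2 ^- n :> R by rewrite (exprVn2S n); lra.
  have := @left_dyadic n.+1 _ k0 (ltW (w0 n.+1)); rewrite nn; exact.
have kw : 2 ^- k <= 2^-1 :> R by exact: (wmono 1).
have I0 : mu `[2^-1, 1[%classic = (2^-1%:E * mass)%E.
  rewrite muL//.
  - by have := ILeft 0; rewrite expr0 invr1 expr1.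
  - by move=> x /=; rewrite !in_itv/=; lra.
  - by move=> x /=; rewrite !in_itv/=; lra.
(* The right half has mass [mass / 2], since [2 ^- k <= 2^-1] makes its right mass vanish, and the
   total is 1. *)
have massE : mass = (2 / 3)%:E.
  have : (mass + 2^-1%:E * mass = 1)%E.
    rewrite -mu_itv01 -I0 -measureU//.
      apply: (measure_eq_mod _ _ mN N0) => //; first exact: measurableU.
        by move=> x [] /=; rewrite !in_itv/= => ?; left; lra.
      move=> x /=; rewrite in_itv/= => x01.
      have [->|x1] := eqVneq x 1; first by right; right.
      have [->|x0] := eqVneq x 0; first by right; left; left.
      left; case: (ltP x 2^-1) => x2; [left|right]; rewrite /= in_itv/= ?x2.
        by rewrite andbT lt_neqAle eq_sym x0; case/andP: x01.
      by rewrite lt_neqAle x1; case/andP: x01.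
    by apply/seteqP; split => // x []/=; rewrite !in_itv/=; lra.
  have : mass \is a fin_num by rewrite fin_mu// => x /=; rewrite !in_itv/=; lra.
  by case: mass => // r _; rewrite -EFinM -EFinD =>
    -[]; move=> ?; congr _%:E; lra.
case: leqP => ki; last first.
  rewrite addr0 muL//; first by rewrite ILeft massE -EFinM mulrC.
  move=> x /=; rewrite !in_itv/=; have := wmono _ _ ki; lra.
rewrite mu_split// ILeft massE.
(* [J] solves [2 ^- i.+1 <= 2 ^- k * (2 * x - 1) < 2 ^- i] for [x]. *)
pose J : set R := `[2^-1 + 2 ^+ k * 2 ^- i.+2, 2^-1 + 2 ^+ k * 2 ^- i.+2 + 2 ^+
  k * 2 ^- i.+2[%classic.
have kE : 2 ^+ k * 2 ^- i.+2 = 2 ^- (i.+2 - k) :> R.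
  have ki2 : (k <= i.+2)%N by rewrite (leq_trans ki)// -addn2 leq_addr.
  by rewrite -[in LHS](subnK ki2) exprD invfM mulrCA mulfV ?mulr1// expf_neq0.
have k2 : 2 * 2 ^- (i.+2 - k) <= 2^-1 :> R.
  by rewrite subSn -?exprVn2S; [apply: (wmono 1); rewrite subn_gt0|exact: leqW].
have ik0 := w0 (i.+2 - k)%N.
have -> : right_measure `[2 ^- i.+1, 2 ^- i[%classic = mu J.
  have E (x : R) : 2^-1 <= x <= 1 ->
      (2 ^- i.+1 <= phi k x < 2 ^- i) = (x \in J).
    move=> x01; rewrite phi_rightE// mulrC ler_pdivlMr ?exprn_gt0//.
    rewrite ltr_pdivrMr ?exprn_gt0// (exprVn2S i) (exprVn2S i.+1) -!mulrA.
    rewrite ![2 ^- _ * _]mulrC kE /J mem_setE in_itv/= kE.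
    by apply/idP/idP; lra.
  congr (mu _); apply/seteqP; split => x /=.
    by rewrite !in_itv/= => -[x01]; rewrite E// inE.
  rewrite /J/= !in_itv/= => xJ.
  have x01 : 2^-1 <= x <= 1 by move: xJ; rewrite kE; lra.
  by split => //; rewrite E// mem_setE in_itv.
rewrite /J kE muL.
- rewrite left_dyadic//; last by lra.
  by rewrite massE -!EFinM -EFinD; congr _%:E; lra.
- exact: measurable_itv.
- by move=> x /=; rewrite !in_itv/=; lra.
- by move=> x /=; rewrite !in_itv/=; lra.
Qed.

(** The formula persists for [k = 0]: it then reduces to [2 ^- i.+1], the uniform mass, because [mu]
    itself is invariant under [fullbranch]. *)
Lemma measure_dyadic i :
  mu `[2 ^- i.+1, 2 ^- i[%classic =
  (2 / 3 * (2 ^- i.+1 + (if (k <= i)%N then 2 ^+ k * 2 ^- i.+2 else 0)))%:E.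
Proof.
have [k0|] := posnP k; last exact: measure_dyadic_pos.
rewrite k0 leq0n expr0 mul1r.
have mu01 : mu `[0, 1[%classic = 1%E.
  rewrite -mu_itv01; apply: (measure_eq_mod _ _ mN N0) => //.
    by move=> x /=; rewrite !in_itv/= => ?; left; lra.
  move=> x /=; rewrite !in_itv/= => x01.
  have [->|x1] := eqVneq x 1; first by right; right.
  by left; rewrite [x < 1]lt_neqAle x1.
have w0 := @exprVn2_gt0 R i.+1; have w1 := @exprVn2_le1 R i.
have nn : 2 ^- i.+1 + 2 ^- i.+1 = 2 ^- i :> R by rewrite (exprVn2S i); lra.
have := @near_uniform_dyadic R mu i.+1 (2 ^- i.+1).
rewrite nn mu01 mule1 => ->; [| |exact: ltW|exact: exprVn2_le1].
  congr _%:E; rewrite (exprVn2S i.+1); lra.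
apply: (approximable_uniform (@spreading_fullbranch R)) => // A mA A01.
have A01' : A `<=` `[0, 1].
  by apply: subset_trans A01 _ => x /=; rewrite !in_itv/=; lra.
rewrite -[RHS]mu_invariant//; apply: (measure_eq_mod _ _ mN N0).
- by apply: measurable_preimage => //; exact: measurable_fullbranch.
- by apply: measurableI => //; apply: measurable_preimage =>
    //; exact: measurable_phi.
- move=> x Ax; left; have := A01 _ Ax; rewrite /= in_itv/= =>
    /andP[/fullbranch_ge0 x01 _].
  split; first by rewrite /= in_itv/=; lra.
  by move: Ax; rewrite k0 /= /fullbranch x01.
- move=> x [/= x01 Ax]; rewrite in_itv/= in x01.
  have [->|x1] := eqVneq x 1; first by right; right.
  have [->|x0] := eqVneq x 0; first by right; left; left.
  have x01' : 0 < x < 1 by rewrite !lt_neqAle x1 eq_sym x0.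
  by left; rewrite /= /fullbranch x01' -k0.
Qed.

End invariant_measure.

(** * Logarithms of the slopes of [phi k] *)

Section slopes.
Context {R : realType}.
Variable k : nat.

Lemma derive1_near_affine (f : R -> R) (c d x : R) :
  (\forall y \near x, f y = c * y + d) -> derive1 f x = c.
Proof.
move=> fcd; rewrite derive1E; apply: derive_val.
have H : is_derive x (1 : R) (fun y : R => c * y + d) c.
  by apply: is_derive_eq; rewrite /GRing.scale/=; lra.
apply: near_eq_is_derive H.
by apply: filterS fcd => y ->.
Qed.

Lemma log2Xn n : log2 (2 ^+ n : R) = n%:R.
Proof.
by rewrite /log2 lnXn// -(mulr_natl (ln 2)) mulfK// gt_eqF// ln_gt0// ltr1n.
Qed.

(** [i] stands for the index [i + 1] of [phi], as in [fullbranchE]. *)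
Definition slope_exponent i : R := if i is 0 then 1 - k%:R else i.+1%:R.

Lemma log2_derive1_phi i x : 2 ^- i.+1 < x < 2 ^- i ->
  log2 (derive1 (@phi R k) x) = slope_exponent i.
Proof.
move=> xi; have xoo : x \in `]2 ^- i.+1, 2 ^- i[ by rewrite in_itv.
case: i xi xoo => [|i] xi xoo.
  rewrite (@derive1_near_affine _ (2 / 2 ^+ k) (- (2 / 2 ^+ k * 2^-1))).
    rewrite /log2 lnM ?posrE ?invr_gt0 ?exprn_gt0// lnV ?posrE ?exprn_gt0//.
    by rewrite mulrDl mulNr -[_ / _]/(log2 (2 ^+ 1)) -[ln (2 ^+ k) / _]/(log2 _)
      !log2Xn.
  apply: filterS (near_in_itvoo xoo) =>
    y; rewrite in_itv/= expr0 invr1 expr1 => y1.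
  by rewrite phi_right ?mulrBr//; lra.
rewrite (@derive1_near_affine _ (2 ^+ i.+2) (-1)) ?log2Xn//.
apply: filterS (near_in_itvoo xoo) => y; rewrite in_itv/= => yi.
by rewrite (@phi_dyadic _ _ i.+2)// ?subn1 ?mulrBr ?mulfV// ltW//=;
  case/andP: yi.
Qed.

End slopes.

(** * Closed forms of the arithmetic-geometric sums *)

Section geometric_moments.
Context {R : realType}.

Lemma geometric_moment n :
  \sum_(i < n) i.+1%:R * 2 ^- i.+1 = 2 - n.+2%:R * 2 ^- n :> R.
Proof.
elim: n => [|n IH]; first by rewrite big_ord0 expr0 invr1 mulr1 subrr.
rewrite big_ord_recr /= IH (exprVn2S n) -!natr1; lra.
Qed.

Lemma geometric_moment_tail k n : (k <= n)%N ->
  \sum_(i < n) i.+1%:R * (if (k <= i)%N then 2 ^+ k * 2 ^- i.+2 else 0) =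
  k.+2%:R / 2 - 2 ^+ k * (n.+2%:R * 2 ^- n.+1) :> R.
Proof.
have vw : 2 ^+ k * 2 ^- k.+1 = 2^-1 :> R.
  have := @exprVn2S R k; have :
    2 ^+ k * 2 ^- k = 1 :> R by rewrite mulfV// expf_neq0.
  by move=> h1 h2; rewrite h2 in h1; lra.
(* The induction starts at [n = k], where all terms vanish and the two terms on the right cancel. *)
move=> /subnKC <-; elim: (n - k)%N => [|m IH].
  rewrite addn0 big1; first by rewrite mulrCA vw subrr.
  by move=> i _; rewrite leqNgt ltn_ord mulr0.
rewrite addnS big_ord_recr /= {}IH leq_addr (exprVn2S (k + m).+1).
have -> : (k + m).+3%:R = (k + m).+1%:R + 2 :> R by rewrite -[(k + m).+3]addn2
  natrD.
have -> : (k + m).+2%:R = (k + m).+1%:R + 1 :> R by rewrite -natr1.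
by ring.
Qed.

Lemma cvg_natr_exprVn2 : n.+2%:R * 2 ^- n @[n --> \oo] --> (0 : R).
Proof.
(* This bounds the sequence by 8 times the harmonic one. *)
have bound n : (n.+1 * n.+2 <= 8 * 2 ^ n)%N.
  elim: n => // n IH; rewrite expnS mulnCA.
  case: n IH => // n IH; apply: leq_trans (leq_mul (leqnn 2) IH).
  by nia.
have h0 : 8 * @harmonic R n @[n --> \oo] --> (0 : R).
  by rewrite -[0](mulr0 8); apply: cvgMr; exact: cvg_harmonic.
apply: (squeeze_cvgr _ (cvg_cst 0) h0); apply: nearW => n /=.
rewrite mulr_ge0 ?invr_ge0 ?exprn_ge0//= ler_pdivrMr ?exprn_gt0// mulrAC.
by rewrite ler_pdivlMr// -natrX -!natrM ler_nat mulnC.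
Qed.

End geometric_moments.

(** * The Lyapunov integral as a series, and its sum *)

Section density_integrals.
Context {R : realType}.
Variables (k : nat) (rho : R -> R).
Hypothesis rho_inv : invariant_density (phi k) rho.

Let mrho : measurable_fun (`[0, 1]%classic : set R) rho.
Proof. by case: rho_inv. Qed.

Let rho0 (x : R) : 0 <= x <= 1 -> 0 <= rho x.
Proof. by case: rho_inv => _ + _ _; apply. Qed.

Lemma density_measure_dyadic i :
  density_measure rho `[2 ^- i.+1, 2 ^- i[%classic =
  (2 / 3 * (2 ^- i.+1 + (if (k <= i)%N then 2 ^+ k * 2 ^- i.+2 else 0)))%:E.
Proof.
case: rho_inv => _ _ rho1 inv.
have [mu muE] := restricted_density_measure mrho rho0.
have muI A : A `<=` `[0, 1] -> mu A = density_measure rho A.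
  by move=> A01; rewrite muE /restricted_density setIidl.
rewrite -muI; last first.
  by move=> x /=; rewrite !in_itv/=; have := @exprVn2_gt0 R i.+1; have :=
    @exprVn2_le1 R i; lra.
apply: measure_dyadic.
- by rewrite muI.
- move=> x; rewrite muE /restricted_density /density_measure.
  exact: integral_Sset1 (@subIsetl _ _ _).
- move=> e e0; rewrite muE; apply: approximable_density => //.
  by rewrite rho1 ltry.
- by move=> A mA A01; rewrite !muI//; exact: inv.
Qed.

Let F x := rho x * log2 (derive1 (phi k) x).

Let sub01 i : `]2 ^- i.+1, 2 ^- i[ `<=` (`[0, 1]%classic : set R).
Proof.
by move=> x /=; rewrite !in_itv/=; have := @exprVn2_gt0 R i.+1; have :=
  @exprVn2_le1 R i; lra.
Qed.

Let mF i : measurable_fun (`]2 ^- i.+1, 2 ^- i[%classic : set R) F.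
Proof.
apply: (eq_measurable_fun (fun x => rho x * slope_exponent k i)).
  by move=> x; rewrite inE/= in_itv/= => xi; rewrite /F (log2_derive1_phi _ xi).
by apply: measurable_funM => //; exact: measurable_funS (@sub01 i) mrho.
Qed.

Let itv01_split : `[0%R, 1%R]%classic =
  (\bigcup_i `](2 ^- i.+1)%R, (2 ^- i)%R[%classic) `|`
  (`[0%R, 1%R]%classic `\` \bigcup_i `](2 ^- i.+1)%R, (2 ^- i)%R[%classic) :>
    set R.
Proof. by rewrite setDUK//; apply: bigcup_sub => i _; exact: sub01. Qed.

Let measurable_ends :
  measurable (`[0, 1]%classic `\` \bigcup_i `]2 ^- i.+1, 2 ^- i[%classic :
    set R).
Proof. by apply: measurableD => //; exact: bigcup_measurable. Qed.

(** The remaining points are 0 and the powers [2 ^- m], enumerated by [z]. *)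
Let countable_ends :
  countable (`[0, 1]%classic `\` \bigcup_i `]2 ^- i.+1, 2 ^- i[%classic :
    set R).
Proof.
pose z n : R := if n is m.+1 then 2 ^- m else 0.
apply: (@sub_countable _ _ _ (range z));
  last exact: (card_le_trans (card_image_le _ _)).
apply: subset_card_le => x [/=]; rewrite in_itv/= => x01 nx.
have [->|x0] := eqVneq x 0; first by exists 0%N.
have [->|x1] := eqVneq x 1; first by exists 1%N; rewrite //= expr0 invr1.
have /dyadic_ex[i /andP[ix xi]] : 0 < x < 1 by rewrite !lt_neqAle x1 eq_sym x0.
exists i.+2 => //=; apply/eqP; apply: contra_notT nx => ne; exists i => //=.
by rewrite in_itv/= xi andbT lt_neqAle ne.
Qed.

(** Nothing is known about [derive1] at the ends of the intervals, but every function is measurable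
    on a countable set. *)
Let mF01 : measurable_fun (`[0, 1]%classic : set R) F.
Proof.
rewrite itv01_split; apply/measurable_funU =>
  //; first exact: bigcup_measurable.
split; first by apply/measurable_fun_bigcup.
move=> _ A mA; apply: countable_measurable => //.
by apply: sub_countable countable_ends; apply: subset_card_le; exact: subIsetl.
Qed.

Let integralF i : (\int[lebesgue_measure]_(x in `](2 ^- i.+1)%R, (2 ^- i)%R[) (F
  x)%:E =
  (slope_exponent k i)%:E * density_measure rho `[(2 ^- i.+1)%R, (2 ^-
    i)%R[%classic)%E.
Proof.
have mrhoi : measurable_fun (`]2 ^- i.+1, 2 ^- i[%classic :
  set R) rho by exact: measurable_funS (@sub01 i) mrho.
rewrite /density_measure -[X in (_ * X)%E]integral_itv_obnd_cbnd; last first.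
  exact/measurable_EFinP.
under eq_integral => x.
  rewrite inE/= in_itv/= => xi; rewrite /F (log2_derive1_phi _ xi) mulrC EFinM.
  over.
rewrite integralZl//.
have rho_int : lebesgue_measure.-integrable `[0%R, 1%R] (EFin \o rho).
  apply/integrableP; split; first exact/measurable_EFinP.
  have rhooo : (density_measure rho `[0%R, 1%R] < +oo)%E.
    by case: rho_inv => _ _ -> _; exact: ltry.
  apply: le_lt_trans rhooo; rewrite le_eqVlt; apply/predU1P; left.
  by apply: eq_integral => x; rewrite inE/= in_itv/= =>
    x01; rewrite ger0_norm// rho0.
apply: (integrableS _ _ _ rho_int) => //; exact: sub01.
Qed.

Let c i : R := 2 / 3 * (2 ^- i.+1 + (if (k <= i)%N then 2 ^+ k * 2 ^- i.+2 else
  0)).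

Lemma lyapunov_exponent_series : lyapunov_exponent (phi k) rho =
  (((1 - k%:R) * c 0%N)%:E + \sum_(i <oo) (i.+2%:R * c i.+1)%:E)%E.
Proof.
rewrite /lyapunov_exponent itv01_split integral_setU//; first last.
- by apply/disj_set2P; rewrite setDE setIC -setIA setICl setI0.
- rewrite -itv01_split; exact/measurable_EFinP.
- exact: bigcup_measurable.
rewrite [X in (_ + X)%E]null_set_integral//; first last.
- exact: countable_lebesgue_measure0.
- apply/measurable_EFinP; apply: measurable_funS mF01 => //; exact: subDsetl.
have O_trivIset : trivIset setT (fun i => `]2 ^- i.+1, 2 ^- i[%classic : set R).
  apply/trivIsetP => i j _ _ ij;
    apply: (@subsetI_eq0 _ _ `[2 ^- i.+1, 2 ^- i[ _ `[2 ^- j.+1, 2 ^- j[).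
  - by move=> x /=; rewrite !in_itv/= => /andP[/ltW-> ->].
  - by move=> x /=; rewrite !in_itv/= => /andP[/ltW-> ->].
  - by move/trivIsetP : (@trivIset_dyadic R); apply.
(* The first interval is split off because its exponent [1 - k] may be negative; on the others the
   integrand is nonnegative and countable additivity applies. *)
rewrite adde0 (bigcup_splitn 1) big_ord1 integral_setU//; first last.
- apply/disj_set2P; rewrite setI_bigcupr; apply: bigcup0 => i _.
  by move/trivIsetP : O_trivIset; apply.
- apply/measurable_EFinP/measurable_funU => //; first exact: bigcup_measurable.
  split; first exact: (@mF 0%N).
  by apply/measurable_fun_bigcup => // i; exact: mF.
- exact: bigcup_measurable.
rewrite integralF density_measure_dyadic -EFinM; congr (_ + _)%E.
rewrite ge0_integral_bigcup//; first last.
- by apply/trivIsetP => i j _ _ ij; move/trivIsetP : O_trivIset; apply.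
- move=> x [i _ xi]; have x01 := @sub01 _ _ xi; rewrite /= in_itv/= in xi.
  rewrite lee_fin (log2_derive1_phi _ xi) mulr_ge0//.
  by apply: rho0; rewrite /= in_itv in x01.
- by apply/measurable_EFinP/measurable_fun_bigcup => // i; exact: mF.
apply: eq_eseriesr => i _.
by rewrite add1n integralF density_measure_dyadic -EFinM.
Qed.

(** This is the mean exponent if the first branch had slope 2: the two moments tend to 2 and
    [k.+2 / 2], and [2 / 3 * (2 + k.+2 / 2)] is [2 + k / 3]. *)
Lemma cvg_exponent_mean :
  \sum_(i < n) i.+1%:R * c i @[n --> \oo] --> (2 + k%:R / 3 : R).
Proof.
have H : 2 / 3 * ((2 - n.+2%:R * 2 ^- n) +
    (k.+2%:R / 2 - 2 ^+ k * 2^-1 * (n.+2%:R * 2 ^- n))) @[n --> \oo] --> (2 +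
      k%:R / 3 : R).
  have -> : 2 + k%:R / 3 = 2 / 3 * ((2 - 0) + (k.+2%:R / 2 - 2 ^+ k * 2^-1 * 0))
    :> R.
    by rewrite -[k.+2]addn2 natrD mulr0; lra.
  by do ![apply: cvgMr | apply: cvgD | apply: cvgN | exact: cvg_cst | exact:
    cvg_natr_exprVn2].
apply: cvg_trans H; apply: near_eq_cvg; near=> n.
have kn : (k <= n)%N by near: n; exact: nbhs_infty_ge.
have -> : 2 ^+ k * 2^-1 * (n.+2%:R * 2 ^- n) =
  2 ^+ k * (n.+2%:R * 2 ^- n.+1) :> R.
  by rewrite (exprVn2S n); lra.
rewrite -geometric_moment -geometric_moment_tail// -big_split mulr_sumr/=.
by apply: eq_bigr => i _; rewrite /c -mulrDr mulrCA.
Unshelve. all: by end_near. Qed.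

(** The true first exponent is [1 - k] instead of 1, which corrects the mean by [- k * c 0]. For
    positive [k], [c 0] is [1 / 3] and the correction cancels [k / 3]; for [k = 0] both vanish. *)
Lemma lyapunov_exponent_phi : lyapunov_exponent (phi k) rho = 2%:E.
Proof.
rewrite lyapunov_exponent_series.
have -> : (\sum_(i <oo) (i.+2%:R * c i.+1)%:E = (2 + k%:R / 3 - c 0%N)%:E)%E.
  apply/cvg_lim => //; apply: cvg_EFin.
    by apply: nearW => n; rewrite sumEFin.
  have -> : fine \o (fun n => \sum_(0 <= i < n) (i.+2%:R * c i.+1)%:E)%E =
      (fun n => \sum_(i < n.+1) i.+1%:R * c i - c 0%N).
    apply/funext => n /=; rewrite sumEFin/= big_mkord big_ord_recl mul1r.
    by rewrite addrAC subrr add0r.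
  apply: cvgB; last exact: cvg_cst.
  by rewrite (cvg_shiftS (fun n =>
    \sum_(i < n) i.+1%:R * c i)); exact: cvg_exponent_mean.
rewrite -EFinD /c; congr _%:E; rewrite leqn0 expr1.
case: (posnP k) => [->|k0]; lra.
Qed.

End density_integrals.

Theorem proposition3 (R : realType) (k : nat) (rho : R -> R)
  (hrho : invariant_density (phi k) rho) :
  lyapunov_exponent (phi k) rho = 2%:E.
Proof. exact: lyapunov_exponent_phi. Qed.
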